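(* Let $G$ be a group with identity $1$, let $R$ be an indecomposable commutative ring with unit and let $\mathscr G$ be a Hausdorff ample $G$-graded groupoid. For $x\in\mathscr G^{(0)}$ let $H_x$ denote the isotropy group at $x$ in the interior of the isotropy bundle of $\mathscr G_1$. Suppose that the set of objects $x\in \mathscr G^{(0)}$ for which $RH_x$ has no non-trivial units is dense in $\mathscr G^{(0)}$. Then $\mathscr G$ satisfies the local bisection hypothesis (relative to $R$ and the grading).
   Context: A commutative ring $R$ with unit is indecomposable if $0\neq 1$ and $0,1$ are its only idempotents. A group ring $RH$ has no non-trivial units if $(RH)^\times=\{rh\mid r\in R^\times, h\in H\}$. Groupoids. A groupoid $\mathscr G$ is a small category with all arrows invertible; $\mathscr G^{(0)}$ is the set of objects (identified with the identity arrows), $\mathscr G^{(1)}$ the set of arrows, $\boldsymbol d,\boldsymbol r$ the domain and range maps; $\alpha\beta$ is defined when $\boldsymbol d(\alpha)=\boldsymbol r(\beta)$. A topological groupoid has topologies making all structure maps continuous; it is étale if $\boldsymbol d$ is a local homeomorphism (then all structure maps are, and $\mathscr G^{(0)}$ is open in $\mathscr G^{(1)}$). A Boolean space is a Hausdorff space with a basis of compact open sets. An ample groupoid is an étale groupoid with $\mathscr G^{(0)}$ a Boolean space; it is Hausdorff if $\mathscr G^{(1)}$ is Hausdorff. The isotropy bundle is the subgroupoid of all arrows $\gamma$ with $\boldsymbol d(\gamma)=\boldsymbol r(\gamma)$; its topological interior is an open étale subgroupoid containing $\mathscr G^{(0)}$. The isotropy group of a groupoid at $x$ is the group of its arrows with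 domain and range $x$. A local bisection is an open subset $U\subseteq\mathscr G^{(1)}$ on which $\boldsymbol d$ and $\boldsymbol r$ are injective. Gradings. A $G$-graded groupoid is a topological groupoid with a continuous functor (cocycle) $c\colon\mathscr G\to G$, $G$ being a discrete one-object groupoid; $\mathscr G_g=c^{-1}(g)$ for $g\in G$. $\mathscr G_1$ is a clopen subgroupoid. Groupoid algebra. $R\mathscr G$ is the $R$-module of compactly supported locally constant functions $\mathscr G^{(1)}\to R$ with product $fg(\gamma)=\sum_{\boldsymbol d(\alpha)=\boldsymbol d(\gamma)}f(\gamma\alpha^{-1})g(\alpha)$. It is $G$-graded, the component $R\mathscr G_g$ consisting of the functions supported on $\mathscr G_g$. The diagonal subalgebra $D(\mathscr G)$ is the set of functions supported on $\mathscr G^{(0)}$. Normalizer. For $g\in G$ let $N_g$ be the set of $m\in R\mathscr G_g$ for which there is $m'\in R\mathscr G_{g^{-1}}$ with $mm'm=m$, $m'mm'=m'$ and $mD(\mathscr G)m'\cup m'D(\mathscr G)m\subseteq D(\mathscr G)$. The (graded) normalizer of $D(\mathscr G)$ is $N=\bigcup_{g\in G}N_g$. $\mathscr G$ satisfies the local bisection hypothesis (relative to $R$ and the grading) if $\mathrm{supp}(m)=\{\gamma\mid m(\gamma)\ne0\}$ is a local bisection for every $m\in N$. *)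

(* Defs.v *)
From HB Require Import structures.
From mathcomp Require Import all_boot all_algebra.
From mathcomp Require Import all_classical topology.

Set Implicit Arguments.
Unset Strict Implicit.
Unset Printing Implicit Defensive.

Import GRing.Theory.
Local Open Scope classical_set_scope.
Local Open Scope ring_scope.

Definition indecomposable (R : comPzRingType) : Prop :=
  0 != 1 :> R /\ forall e : R, e * e = e -> e = 0 \/ e = 1.

Section GroupRing.
Context (R : comPzRingType) (H : groupType).
Implicit Types u v : H -> R.

Definition group_ring : set (H -> R) :=
  [set u | finite_set [set h | u h != 0]].

Definition group_ring_mul u v : H -> R :=
  fun h => \sum_(k \in [set: H]) u (h * k^-1)%g * v k.

Definition group_ring_monomial (r : R) (h : H) : H -> R :=
  fun k => if k == h then r else 0.

Definition group_ring_one : H -> R := group_ring_monomial 1 1%g.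

Definition group_ring_units : set (H -> R) :=
  [set u | group_ring u /\
    exists2 v, group_ring v &
      group_ring_mul u v = group_ring_one /\
      group_ring_mul v u = group_ring_one].

Definition no_nontrivial_units : Prop :=
  group_ring_units =
  [set u | exists (r : R) (h : H),
     (exists s, r * s = 1) /\ u = group_ring_monomial r h].

End GroupRing.

Arguments no_nontrivial_units : clear implicits.

(* [comp a b] is the composite of a and b when [dom a = rng b]; its value on
   other pairs is junk that no axiom constrains. *)
Record topological_groupoid := TopologicalGroupoid {
  obj : topologicalType;
  arr : topologicalType;
  dom : arr -> obj;
  rng : arr -> obj;
  idm : obj -> arr;
  inv : arr -> arr;
  comp : arr -> arr -> arr;
  dom_idm : forall x, dom (idm x) = x;
  rng_idm : forall x, rng (idm x) = x;
  dom_comp : forall a b, dom a = rng b -> dom (comp a b) = dom b;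
  rng_comp : forall a b, dom a = rng b -> rng (comp a b) = rng a;
  compA : forall a b c, dom a = rng b -> dom b = rng c ->
    comp a (comp b c) = comp (comp a b) c;
  comp_idm : forall a, comp a (idm (dom a)) = a;
  idm_comp : forall a, comp (idm (rng a)) a = a;
  dom_inv : forall a, dom (inv a) = rng a;
  rng_inv : forall a, rng (inv a) = dom a;
  comp_inv : forall a, comp a (inv a) = idm (rng a);
  inv_comp : forall a, comp (inv a) a = idm (dom a);
  dom_continuous : continuous dom;
  rng_continuous : continuous rng;
  idm_continuous : continuous idm;
  inv_continuous : continuous inv;
  comp_continuous : {within [set p : arr * arr | dom p.1 = rng p.2],
    continuous (fun p : arr * arr => comp p.1 p.2)}
}.

Definition local_homeomorphism (X Y : topologicalType) (f : X -> Y) : Prop :=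
  forall x, exists U : set X, [/\ open U, U x, open (f @` U) &
    exists g : Y -> X, [/\ {within U, continuous f},
      {within f @` U, continuous g} & {in U, cancel f g}]].

Record etale_groupoid := EtaleGroupoid {
  etale_topological :> topological_groupoid;
  etale_dom : local_homeomorphism (@dom etale_topological)
}.

Definition boolean_space (X : topologicalType) : Prop :=
  hausdorff_space X /\ basis [set U : set X | open U /\ compact U].

Definition ample (GG : etale_groupoid) : Prop := boolean_space (obj GG).

Definition local_bisection (GG : topological_groupoid) (U : set (arr GG)) :
    Prop :=
  [/\ open U, {in U &, injective (@dom GG)} & {in U &, injective (@rng GG)}].

(* All subgroupoids are wide, i.e. have the same objects as GG. *)
Record subgroupoid (GG : topological_groupoid) := Subgroupoid {
  sub_arr :> set (arr GG);
  sub_idm : forall x, sub_arr (idm x);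
  sub_inv : forall a, sub_arr a -> sub_arr (inv a);
  sub_comp : forall a b, sub_arr a -> sub_arr b -> dom a = rng b ->
    sub_arr (comp a b)
}.

Definition isotropy_bundle (GG : topological_groupoid) (S : subgroupoid GG) :
    set (arr GG) :=
  [set a | sub_arr S a /\ dom a = rng a].

(* The interior is taken in the subspace S; it lies in S because
   [isotropy_bundle S] does. *)
Definition isotropy_interior_arr (GG : topological_groupoid)
    (S : subgroupoid GG) : set (arr GG) :=
  interior (isotropy_bundle S : set (subspace S)).

Section IsotropyInterior.
Context (GG : etale_groupoid) (S : subgroupoid GG) (openS : open S).

Lemma isotropy_interior_arrE a :
  isotropy_interior_arr S a = interior (isotropy_bundle S) a.
Proof.
rewrite propeqE /isotropy_interior_arr /interior; split.
  move=> iSa; have [Sa _] : isotropy_bundle S a by exact: nbhs_singleton iSa.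
  move: iSa; rewrite -(nbhs_subspace_interior (A := S)) //.
  by apply: open_nbhs_nbhs.
move=> iSa; have [Sa _] : isotropy_bundle S a by exact: nbhs_singleton iSa.
rewrite -(nbhs_subspace_interior (A := S)) //.
by apply: open_nbhs_nbhs.
Qed.

Lemma isotropy_interior_idm x : isotropy_interior_arr S (idm x).
Proof.
rewrite isotropy_interior_arrE /interior.
have [U [oU Ux _ [g [_ _ gK]]]] := etale_dom (idm x).
have UU : \forall a \near idm x, U a by apply: open_nbhs_nbhs.
have SS : \forall a \near idm x, sub_arr S a.
  by apply: open_nbhs_nbhs; split => //; exact: sub_idm.
have UI : \forall a \near idm x, U (idm (dom a)).
  have cI : {for idm x, continuous (@idm GG \o @dom GG)}.
    by apply: continuous_comp; [exact: dom_continuous | exact: idm_continuous].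
  by apply: cI; rewrite /= dom_idm; apply: open_nbhs_nbhs.
near=> a; split; first by near: a.
have Ua : U a by near: a.
have Ua' : U (idm (dom a)) by near: a.
have -> : a = idm (dom a).
  by rewrite -[LHS]gK ?inE // -[RHS]gK ?inE // dom_idm.
by rewrite dom_idm rng_idm.
Unshelve. all: by end_near. Qed.

Lemma isotropy_interior_inv a :
  isotropy_interior_arr S a -> isotropy_interior_arr S (inv a).
Proof.
have invK b : inv (inv b) = b :> arr GG.
  rewrite -[LHS]comp_idm dom_inv rng_inv -inv_comp compA ?dom_inv ?rng_inv //.
  by rewrite inv_comp dom_inv idm_comp.
rewrite !isotropy_interior_arrE /interior => iSa.
have : \forall b \near inv a, isotropy_bundle S (inv b).
  by apply: inv_continuous; rewrite invK.
apply: filterS => b [Sb]; rewrite dom_inv rng_inv => eb; split => //.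
by rewrite -[b]invK; exact: sub_inv.
Qed.

Lemma isotropy_interior_comp a b :
  isotropy_interior_arr S a -> isotropy_interior_arr S b -> dom a = rng b ->
  isotropy_interior_arr S (comp a b).
Proof.
rewrite !isotropy_interior_arrE /interior => iSa iSb ab.
have [U [oU Ub oV [g [_ cg gK]]]] := etale_dom b.
pose s (e : arr GG) := g (dom e).
have sab : s (comp a b) = b by rewrite /s dom_comp // gK ?inE.
have cs : s @ comp a b --> b.
  rewrite -{2}sab; apply: continuous_comp; first exact: dom_continuous.
  rewrite continuous_open_subspace in cg => //; apply: cg; rewrite inE.
  by rewrite dom_comp //; exists b.
have nV : \forall e \near comp a b, (@dom GG @` U) (dom e).
  apply: dom_continuous; apply: open_nbhs_nbhs; split => //.
  by rewrite dom_comp //; exists b.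
have nb : \forall e \near comp a b, isotropy_bundle S (s e) by apply: cs.
have dcomp e : (@dom GG @` U) (dom e) -> dom e = rng (inv (s e)).
  by case=> u Uu ue; rewrite rng_inv /s -ue gK ?inE.
have na : \forall e \near comp a b, isotropy_bundle S (comp e (inv (s e))).
  have aE : comp (comp a b) (inv (s (comp a b))) = a.
    by rewrite sab -compA ?rng_inv // comp_inv -ab comp_idm.
  pose p (e : arr GG) := (e, inv (s e)).
  pose D := [set q : arr GG * arr GG | dom q.1 = rng q.2].
  have cp : p @ comp a b --> p (comp a b).
    apply: cvg_pair; first exact: cvg_id.
    have := cvg_comp _ _ cs (@inv_continuous GG b).
    by rewrite -{2}sab.
  have Dp : D (p (comp a b)).
    by rewrite /D /p /= sab dom_comp // rng_inv.
  have /subspace_continuousP/(_ _ Dp)/(_ (isotropy_bundle S)) :=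
    @comp_continuous GG.
  rewrite /from_subspace /= aE => /(_ iSa) /cp.
  apply: filterS2 nV => e Ve; apply; exact: dcomp.
near=> e.
have Ve : (@dom GG @` U) (dom e) by near: e.
have [S1 e1] : isotropy_bundle S (comp e (inv (s e))) by near: e.
have [S2 e2] : isotropy_bundle S (s e) by near: e.
have de := dcomp e Ve.
have ds : dom e = dom (s e) by rewrite de rng_inv.
have eE : comp (comp e (inv (s e))) (s e) = e.
  by rewrite -compA ?dom_inv // inv_comp -ds comp_idm.
move: e1; rewrite dom_comp // rng_comp // dom_inv => e1.
split; last by rewrite ds e2.
by rewrite -eE; apply: sub_comp => //; rewrite dom_comp ?dom_inv.
Unshelve. all: by end_near. Qed.

Definition isotropy_interior : subgroupoid GG :=
  Subgroupoid isotropy_interior_idm isotropy_interior_inv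
    isotropy_interior_comp.

End IsotropyInterior.

Definition isotropy_at (GG : topological_groupoid) (S : subgroupoid GG)
    (x : obj GG) : set (arr GG) :=
  [set a | sub_arr S a /\ dom a = x /\ rng a = x].

Definition isotropy_group (GG : topological_groupoid) (S : subgroupoid GG)
    (x : obj GG) : Type :=
  set_type (isotropy_at S x).

Section IsotropyGroup.
Context (GG : topological_groupoid) (S : subgroupoid GG) (x : obj GG).
Local Notation H := (isotropy_group S x).
Implicit Types a b : H.

HB.instance Definition _ := Choice.copy H (set_type (isotropy_at S x)).

Lemma isotropy_groupP a :
  sub_arr S (\val a) /\ dom (\val a) = x /\ rng (\val a) = x.
Proof. by have := valP a; rewrite inE. Qed.

Lemma isotropy_one_subproof : idm x \in isotropy_at S x.
Proof.
by rewrite inE /isotropy_at /= dom_idm rng_idm; split; first exact: sub_idm.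
Qed.

Lemma isotropy_inv_subproof a :
  inv (\val a) \in isotropy_at S x.
Proof.
have [Sa [da ra]] := isotropy_groupP a.
by rewrite inE /isotropy_at /= dom_inv rng_inv; split; first exact: sub_inv.
Qed.

Lemma isotropy_mul_subproof a b :
  comp (\val a) (\val b) \in isotropy_at S x.
Proof.
have [Sa [da ra]] := isotropy_groupP a; have [Sb [db rb]] := isotropy_groupP b.
rewrite inE /isotropy_at /= dom_comp ?rng_comp ?da ?rb //; split => //.
by apply: sub_comp; rewrite ?da.
Qed.

Definition isotropy_one : H :=
  exist (fun e => e \in isotropy_at S x) _ isotropy_one_subproof.
Definition isotropy_inv a : H :=
  exist (fun e => e \in isotropy_at S x) _ (isotropy_inv_subproof a).
Definition isotropy_mul a b : H :=
  exist (fun e => e \in isotropy_at S x) _ (isotropy_mul_subproof a b).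

Lemma isotropy_mulA : associative isotropy_mul.
Proof.
move=> a b c; apply: val_inj => /=; apply: compA.
- by rewrite (isotropy_groupP a).2.1 (isotropy_groupP b).2.2.
- by rewrite (isotropy_groupP b).2.1 (isotropy_groupP c).2.2.
Qed.

Lemma isotropy_mul1g : left_id isotropy_one isotropy_mul.
Proof.
move=> a; apply: val_inj => /=.
by rewrite -[in idm _](isotropy_groupP a).2.2 idm_comp.
Qed.

Lemma isotropy_mulg1 : right_id isotropy_one isotropy_mul.
Proof.
move=> a; apply: val_inj => /=.
by rewrite -[in idm _](isotropy_groupP a).2.1 comp_idm.
Qed.

Lemma isotropy_mulVg : left_inverse isotropy_one isotropy_inv isotropy_mul.
Proof.
by move=> a; apply: val_inj; rewrite /= inv_comp (isotropy_groupP a).2.1.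
Qed.

Lemma isotropy_mulgV : right_inverse isotropy_one isotropy_inv isotropy_mul.
Proof.
by move=> a; apply: val_inj; rewrite /= comp_inv (isotropy_groupP a).2.2.
Qed.

HB.instance Definition _ := isGroup.Build H isotropy_mulA isotropy_mul1g
  isotropy_mulg1 isotropy_mulVg isotropy_mulgV.

End IsotropyGroup.

Record cocycle (GG : topological_groupoid) (G : groupType) := Cocycle {
  cocycle_fun :> arr GG -> G;
  cocycle_idm : forall x, cocycle_fun (idm x) = 1%g;
  cocycle_comp : forall a b, dom a = rng b ->
    cocycle_fun (comp a b) = (cocycle_fun a * cocycle_fun b)%g;
  cocycle_continuous : continuous (cocycle_fun : arr GG -> discrete_topology G)
}.

Definition homogeneous_arr (GG : topological_groupoid) (G : groupType)
    (c : cocycle GG G) (g : G) : set (arr GG) := c @^-1` [set g].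

Section TrivialComponent.
Context (GG : topological_groupoid) (G : groupType) (c : cocycle GG G).

Lemma homogeneous1_idm x : homogeneous_arr c 1%g (idm x).
Proof. exact: cocycle_idm. Qed.

Lemma homogeneous1_inv a :
  homogeneous_arr c 1%g a -> homogeneous_arr c 1%g (inv a).
Proof.
rewrite /homogeneous_arr /= => ca.
have := cocycle_comp c (esym (rng_inv a)).
by rewrite comp_inv cocycle_idm ca mul1g.
Qed.

Lemma homogeneous1_comp a b : homogeneous_arr c 1%g a ->
  homogeneous_arr c 1%g b -> dom a = rng b -> homogeneous_arr c 1%g (comp a b).
Proof.
by rewrite /homogeneous_arr /= => ca cb ab; rewrite cocycle_comp // ca cb mulg1.
Qed.

Definition trivial_component : subgroupoid GG :=
  Subgroupoid homogeneous1_idm homogeneous1_inv homogeneous1_comp.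

Lemma open_trivial_component : open trivial_component.
Proof.
have /continuousP := @cocycle_continuous _ _ c; apply.
exact: (@discrete_open (discrete_topology G)).
Qed.

End TrivialComponent.

Definition interior_isotropy_group (GG : etale_groupoid) (G : groupType)
    (c : cocycle GG G) (x : obj GG) : groupType :=
  isotropy_group (isotropy_interior (open_trivial_component c)) x.

Section GroupoidAlgebra.
Context (R : comPzRingType) (GG : topological_groupoid).
Implicit Types f g m : arr GG -> R.

Definition supp f : set (arr GG) := [set a | f a != 0].

Definition locally_constant f : Prop :=
  forall a, \forall b \near a, f b = f a.

(* The support of a locally constant function is closed, so that [supp] is the
   support in the topological sense too. *)
Definition groupoid_algebra : set (arr GG -> R) :=
  [set f | locally_constant f /\ compact (supp f)].

(* In an étale Hausdorff groupoid the sum below has finitely many nonzero terms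
   when f and g are in the groupoid algebra. *)
Definition convolution f g : arr GG -> R :=
  fun c => \sum_(a \in [set a | dom a = dom c]) f (comp c (inv a)) * g a.

Definition diagonal : set (arr GG -> R) :=
  [set f | groupoid_algebra f /\ supp f `<=` range (@idm GG)].

Context (G : groupType) (c : cocycle GG G).

Definition groupoid_algebra_component (g : G) : set (arr GG -> R) :=
  [set f | groupoid_algebra f /\ supp f `<=` homogeneous_arr c g].

Definition normalizer_component (g : G) : set (arr GG -> R) :=
  [set m | groupoid_algebra_component g m /\
    exists2 m', groupoid_algebra_component g^-1%g m' &
      [/\ convolution (convolution m m') m = m,
          convolution (convolution m' m) m' = m',
          forall f, diagonal f -> diagonal (convolution (convolution m f) m')
        & forall f, diagonal f ->
            diagonal (convolution (convolution m' f) m)]].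

Definition graded_normalizer : set (arr GG -> R) :=
  \bigcup_g normalizer_component g.

Definition local_bisection_hypothesis : Prop :=
  forall m, graded_normalizer m -> local_bisection (supp m).

End GroupoidAlgebra.

Arguments local_bisection_hypothesis : clear implicits.
Arguments local_bisection_hypothesis R {GG G} c.

(* Main.v *)
(* Let m be a normalizer with partner m'. For W compact open, the function
   h = m' 1_W m is diagonal, its values are idempotents of R, hence 0 or 1, and
   m(a) h(dom a) = 1_W(rng a) m(a). So on supp m the domain determines the
   range; with m 1_W m' instead, the range determines the domain. Hence, if a
   and b in supp m have the same domain, the local section of dom through b
   shows that a^-1 b lies in the interior of the isotropy bundle of the
   component of degree 1.
   If m took nonzero values at two arrows with the same domain, then, moving
   along local sections and using density, we may assume that their domain x is
   such that R H_x has only trivial units. For a in supp m with domain x, the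
   elements sum_h m(a h) h and sum_h m'(h a^-1) h are mutually inverse in R H_x,
   because m' m and m m' are diagonal. So the first one is a monomial, and a is
   the only element of supp m with domain x. *)
From Pilot Require Import Defs.
From mathcomp Require Import all_boot all_algebra.
From mathcomp Require Import all_classical topology.
(* Again, because MathComp has its own [comp]. *)
Import Pilot.Defs.

Set Implicit Arguments.
Unset Strict Implicit.
Unset Printing Implicit Defensive.

Import GRing.Theory.
Local Open Scope classical_set_scope.
Local Open Scope ring_scope.

(** * Cancellation laws in a groupoid *)

Section GroupoidLaws.
Context (GG : topological_groupoid).
Implicit Types a b : arr GG.

Lemma comp_invK a b : dom a = dom b -> comp (comp a (inv b)) b = a.
Proof.
by move=> ab; rewrite -compA ?rng_inv ?dom_inv // inv_comp -ab comp_idm.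
Qed.

Lemma compK a b : dom a = rng b -> comp (comp a b) (inv b) = a.
Proof. by move=> ab; rewrite -compA ?rng_inv // comp_inv -ab comp_idm. Qed.

Lemma compKV a b : dom a = rng b -> comp (inv a) (comp a b) = b.
Proof. by move=> ab; rewrite compA ?dom_inv // inv_comp ab idm_comp. Qed.

Lemma compVK a b : rng a = rng b -> comp a (comp (inv a) b) = b.
Proof.
by move=> ab; rewrite compA ?rng_inv ?dom_inv // comp_inv ab idm_comp.
Qed.

Lemma invK : involutive (@inv GG).
Proof.
move=> a; rewrite -[LHS]comp_idm dom_inv rng_inv -inv_comp.
by rewrite compA ?dom_inv ?rng_inv // inv_comp dom_inv idm_comp.
Qed.

Lemma inv_compE a b : dom a = rng b ->
  inv (comp a b) = comp (inv b) (inv a).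
Proof.
move=> ab; have dc : dom (comp a b) = dom b by rewrite dom_comp.
rewrite -[RHS](compK (b := comp a b)) ?dom_comp ?dom_inv ?rng_inv ?rng_comp //.
rewrite -[comp (comp _ _) (comp a b)]compA ?dom_inv ?rng_inv ?rng_comp //.
by rewrite compKV // inv_comp -dc -rng_inv idm_comp.
Qed.

Lemma inv_idm (x : obj GG) : inv (idm x) = idm x.
Proof.
have := comp_idm (inv (idm x)).
by rewrite dom_inv rng_idm inv_comp dom_idm.
Qed.

Lemma unit_idm_dom a : range (@idm GG) a -> a = idm (dom a).
Proof. by case=> x _ <-; rewrite dom_idm. Qed.

End GroupoidLaws.

(** * Convolution as sums over domain fibres *)

Lemma fsum_mulr_idem (R : comPzRingType) (I : choiceType) (D : set I)
    (w : I -> R) :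
  finite_set (D `&` [set a | w a != 0]) ->
  (forall a, D a -> w a * (\sum_(b \in D) w b) = w a) ->
  (\sum_(a \in D) w a) * (\sum_(a \in D) w a) = \sum_(a \in D) w a.
Proof.
move=> fD wE; rewrite (full_fsbig_distrr _ _ (P := D)); last first.
  by apply: sub_finite_set fD => a [Da /eqP wa].
by apply: eq_fsbigr => a /set_mem Da; rewrite /= mulrC wE.
Qed.

Section Convolution.
Context (R : comPzRingType) (GG : topological_groupoid).
Implicit Types f g h : arr GG -> R.

(** The finiteness on domain fibres that convolution sums need. It stands in for compact support, so
    that the algebra below is free of topology. *)
Definition dom_finite f : Prop :=
  forall x, finite_set [set a | dom a = x /\ f a != 0].

Lemma convolution_unitr f g a : supp g `<=` range (@idm GG) ->
  convolution f g a = f a * g (idm (dom a)).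
Proof.
move=> gu; rewrite /convolution.
rewrite -(@fsbig_widen _ _ _ _ [set idm (dom a)]).
- by rewrite fsbig_set1 inv_idm comp_idm.
- by move=> _ ->; rewrite /= dom_idm.
- move=> b [/= ba bN]; have [->|gb] := eqVneq (g b) 0; first by rewrite mulr0.
  by case: bN; rewrite -ba; apply/unit_idm_dom/gu.
Qed.

Lemma convolution_unitl f g a : supp f `<=` range (@idm GG) ->
  convolution f g a = f (idm (rng a)) * g a.
Proof.
move=> fu; rewrite /convolution.
rewrite -(@fsbig_widen _ _ _ _ [set a]).
- by rewrite fsbig_set1 comp_inv.
- by move=> _ ->.
- move=> b [/= ba bN].
  have [->|fb] := eqVneq (f (comp a (inv b))) 0; first by rewrite mul0r.
  case: bN; rewrite -[b]idm_comp -dom_inv.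
  rewrite -(@dom_comp _ a) ?rng_inv // -(unit_idm_dom (fu _ fb)).
  by rewrite comp_invK.
Qed.

(** Both sides are the sum of [f (c a^-1) g (a b^-1) h b] over [a] and [b] with the domain of [c].
    The conditions on [g] and [h] confine [b] to the finite set [B] and [a] to the finite set [A],
    so the two sums may be exchanged. *)
Lemma convolutionA f g h : dom_finite g -> dom_finite h ->
  convolution (convolution f g) h = convolution f (convolution g h).
Proof.
move=> fg fh; apply/funext => c; rewrite /convolution.
set x := dom c.
pose B := [set b | dom b = x /\ h b != 0].
have fB : finite_set B by exact: fh.
pose A := \bigcup_(b in B) ((fun a => comp a b) @`
  [set a | dom a = rng b /\ g a != 0]).
have fA : finite_set A.
  by apply: bigcup_finite => // b _; apply: finite_image; exact: fg.
have restrB (F : arr GG -> R) : \sum_(b \in [set b | dom b = x]) F b * h b =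
    \sum_(b \in B) F b * h b.
  apply/esym/fsbig_widen => b; first by case.
  move=> [/= bx nB]; have [->|hb] := eqVneq (h b) 0; first by rewrite mulr0.
  by case: nB.
have AE a b : dom a = x -> B b -> ~ A a -> g (comp a (inv b)) = 0.
  move=> ax Bb nA; have [//|ga] := eqVneq (g (comp a (inv b))) 0.
  have ab : dom a = dom b by rewrite Bb.1.
  by case: nA; exists b => //; exists (comp a (inv b)); rewrite ?comp_invK //=
    dom_comp ?dom_inv ?rng_inv.
have Adom a : A a -> dom a = x.
  by case=> b [bx _] [a' [a'b _] <-]; rewrite dom_comp.
rewrite restrB.
transitivity (\sum_(b \in B) \sum_(a \in A)
    f (comp c (inv a)) * (g (comp a (inv b)) * h b)).
  apply: eq_fsbigr => b /set_mem Bb; have bx := Bb.1.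
  have cb : dom c = rng (inv b) by rewrite rng_inv bx.
  rewrite dom_comp // dom_inv.
  (* Right translation by [inv b] maps the domain fibre of [x] bijectively onto that of [rng b]. *)
  rewrite (@reindex_fsbig _ _ _ _ _ (fun a => comp a (inv b))
     [set a | dom a = x]); last first.
    split.
    - by move=> a /= ax; rewrite dom_comp ?dom_inv // rng_inv ax bx.
    - move=> a a' /set_mem /= ax /set_mem /= a'x e.
      by rewrite -[a](@comp_invK _ _ b) ?ax ?bx // e comp_invK ?a'x ?bx.
    - move=> a /= ab; exists (comp a b); last by rewrite compK.
      by rewrite /= dom_comp.
  rewrite -(@fsbig_widen _ _ _ _ A); first last.
  - by move=> a [/= ax nA]; rewrite AE // mulr0.
  - by move=> a /Adom.
  rewrite mulrC (full_fsbig_distrr _ _ (P := A)); last first.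
    by apply: sub_finite_set fA => a [].
  apply: eq_fsbigr => a /set_mem /Adom ax.
  rewrite /= mulrC mulrA; congr (f _ * _ * _).
  rewrite inv_compE ?rng_inv ?ax ?bx // invK.
  by rewrite compA ?dom_comp ?dom_inv ?rng_inv ?ax ?bx // comp_invK.
rewrite exchange_fsbig //.
rewrite -(@fsbig_widen _ _ _ _ A [set a | dom a = x]); first last.
- move=> a [/= ax nA]; rewrite ax restrB fsbig1 ?mulr0 // => b Bb.
  by rewrite AE // mul0r.
- by move=> a /Adom.
apply: eq_fsbigr => a /set_mem /Adom ax; rewrite ax restrB.
rewrite (full_fsbig_distrr _ _ (P := B)) //.
by apply: sub_finite_set fB => b [].
Qed.

Lemma convolution_idm f g (x : obj GG) : convolution f g (idm x) =
  \sum_(a \in [set a | dom a = x]) f (inv a) * g a.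
Proof.
rewrite /convolution dom_idm; apply: eq_fsbigr => a /set_mem /= <-.
by rewrite -rng_inv idm_comp.
Qed.

(** If each term of a finite sum absorbs the whole sum, then the sum is idempotent, and an
    indecomposable ring leaves only 0 and 1. *)
Lemma convolution_idm01 f g (x : obj GG) :
  indecomposable R -> dom_finite g ->
  (forall a, dom a = x ->
    f (inv a) * g a * convolution f g (idm x) = f (inv a) * g a) ->
  convolution f g (idm x) = 0 \/ convolution f g (idm x) = 1.
Proof.
move=> [_ Rid] gfin; rewrite convolution_idm => wE.
apply/Rid/fsum_mulr_idem => //; apply: sub_finite_set (gfin x) => a [/= ax wa].
by split=> //; apply: contraNneq wa => ->; rewrite mulr0.
Qed.

Lemma dom_finite_unit f : supp f `<=` range (@idm GG) -> dom_finite f.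
Proof.
move=> fu x; apply: (sub_finite_set _ (finite_set1 (idm x))) => a [<- fa].
exact/unit_idm_dom/fu.
Qed.

Lemma dom_finite_sub f g :
  (forall a, g a = 0 -> f a = 0) -> dom_finite g -> dom_finite f.
Proof.
move=> fg gfin x; apply: sub_finite_set (gfin x) => a [/= ax fa].
by split=> //; apply: contraNneq fa => /fg ->.
Qed.

End Convolution.

(** * Domains and ranges on the support of a normalizer *)

Section NormalizerFibers.
Context (R : comPzRingType) (GG : topological_groupoid).
Hypothesis Rind : indecomposable R.
Context (m m' : arr GG -> R).
Hypothesis (mfin : dom_finite m) (m'fin : dom_finite m').
Hypothesis mm'm : convolution (convolution m m') m = m.
Hypothesis mm'_unit : supp (convolution m m') `<=` range (@idm GG).
Hypothesis m'm_unit : supp (convolution m' m) `<=` range (@idm GG).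

Lemma mm'_rngK a : convolution m m' (idm (rng a)) * m a = m a.
Proof. by rewrite -convolution_unitl // mm'm. Qed.

Lemma m'm_domK a : m a * convolution m' m (idm (dom a)) = m a.
Proof. by rewrite -convolution_unitr // -convolutionA // mm'm. Qed.

(** The value fixes every [m b] with [rng b = rng a], so each term of its defining sum absorbs it
    and it is 0 or 1. It cannot be 0, since it fixes [m a]. *)
Lemma mm'_rng1 a : m a != 0 -> convolution m m' (idm (rng a)) = 1.
Proof.
move=> ma; have [|e0|//] := @convolution_idm01 _ _ m m' (rng a) Rind m'fin.
  move=> b ba; rewrite mulrAC -ba -rng_inv.
  by rewrite [m _ * convolution _ _ _]mulrC mm'_rngK.
by move: ma; rewrite -mm'_rngK e0 mul0r eqxx.
Qed.

Lemma m'm_dom1 a : m a != 0 -> convolution m' m (idm (dom a)) = 1.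
Proof.
move=> ma; have [|e0|//] := @convolution_idm01 _ _ m' m (dom a) Rind mfin.
  by move=> b ba; rewrite -mulrA -ba m'm_domK.
by move: ma; rewrite -m'm_domK e0 mulr0 eqxx.
Qed.

Section Diagonal.
Context (f : arr GG -> R).
Hypothesis f_unit : supp f `<=` range (@idm GG).
Hypothesis f01 : forall a, f a * f a = f a.
Hypothesis mfm'_unit :
  supp (convolution (convolution m f) m') `<=` range (@idm GG).
Hypothesis m'fm_unit :
  supp (convolution (convolution m' f) m) `<=` range (@idm GG).

Let ffin : dom_finite f := dom_finite_unit f_unit.

(** Reassociate [m (m' f m)] as [(m m') (f m)]: the diagonal function [m m'] acts as the identity at
    ranges of arrows in the support of [m]. *)
Lemma conj_dom a : m a * convolution (convolution m' f) m (idm (dom a)) =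
  f (idm (rng a)) * m a.
Proof.
have fmE : convolution f m = fun b => f (idm (rng b)) * m b.
  by apply/funext => b; rewrite convolution_unitl.
have fmfin : dom_finite (convolution f m).
  by apply: dom_finite_sub mfin => b; rewrite fmE => ->; rewrite mulr0.
rewrite -convolution_unitr // convolutionA // -convolutionA //.
by rewrite convolution_unitl // fmE mulrCA mm'_rngK.
Qed.

Lemma conj_rng a : convolution (convolution m f) m' (idm (rng a)) * m a =
  m a * f (idm (dom a)).
Proof.
rewrite -convolution_unitl // convolutionA // convolution_unitr //.
by rewrite convolution_unitr // mulrAC m'm_domK.
Qed.

(** A term is [m' (a^-1) f (rng a) m a]. By [conj_dom], multiplying it by the sum contributes a
    second factor [f (rng a)], which idempotence of [f] absorbs. *)
Lemma conj_dom01 x :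
  let h := convolution (convolution m' f) m (idm x) in h = 0 \/ h = 1.
Proof.
apply: convolution_idm01 => // a <-; rewrite convolution_unitr // dom_inv.
by rewrite -!mulrA conj_dom; congr (_ * _); rewrite mulrA f01.
Qed.

Lemma conj_rng01 x :
  let h := convolution (convolution m f) m' (idm x) in h = 0 \/ h = 1.
Proof.
apply: convolution_idm01 => // a <-; rewrite convolution_unitr //.
rewrite mulrAC; congr (_ * _).
rewrite -[dom a]rng_inv mulrAC [m _ * convolution _ _ _]mulrC.
by rewrite conj_rng -mulrA f01.
Qed.

(** Let [h] be the value of [m' f m] at the common domain. If [h] is 0, then [conj_dom] at [a] kills
    [m a]; if [h] is 1, then [conj_dom] at [b] kills [m b]. *)
Lemma supp_rng_indicator a b : m a != 0 -> m b != 0 -> dom a = dom b ->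
  f (idm (rng a)) = 1 -> f (idm (rng b)) = 0 -> False.
Proof.
move=> ma mb ab fa fb; have := conj_dom a; have := conj_dom b; rewrite fa fb.
rewrite -ab mul0r mul1r; have [->|->] := conj_dom01 (dom a).
  by rewrite !mulr0 => _ e; rewrite -e eqxx in ma.
by rewrite !mulr1 => e; rewrite e eqxx in mb.
Qed.

Lemma supp_dom_indicator a b : m a != 0 -> m b != 0 -> rng a = rng b ->
  f (idm (dom a)) = 1 -> f (idm (dom b)) = 0 -> False.
Proof.
move=> ma mb ab fa fb; have := conj_rng a; have := conj_rng b; rewrite fa fb.
rewrite -ab mulr0 mulr1; have [->|->] := conj_rng01 (rng a).
  by rewrite !mul0r => _ e; rewrite -e eqxx in ma.
by rewrite !mul1r => e; rewrite e eqxx in mb.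
Qed.

End Diagonal.

(** * Units of the isotropy group ring *)

Section Isotropy.
Context (S : subgroupoid GG) (a : arr GG).
Hypothesis ma : m a != 0.
Local Notation H := (isotropy_group S (dom a)).
(** Both alternatives concern [m] alone: the sum for [m' m] evaluates [m] at arrows with the domain
    of [a], the sum for [m m'] at arrows with the range of [a]. *)
Hypothesis supp_isotropy : forall b, m b != 0 ->
  dom b = dom a \/ rng b = rng a -> exists h : H, b = comp a (\val h).

Let v (h : H) : R := m (comp a (\val h)).
Let w (h : H) : R := m' (comp (\val h) (inv a)).

Let domH (h : H) : dom (\val h) = dom a.
Proof. exact: (isotropy_groupP h).2.1. Qed.

Let rngH (h : H) : rng (\val h) = dom a.
Proof. exact: (isotropy_groupP h).2.2. Qed.

Let valM (h k : H) : \val (h * k)%g = comp (\val h) (\val k).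
Proof. by []. Qed.

Let valV (h : H) : \val h^-1%g = inv (\val h).
Proof. by []. Qed.

Let val_idm (h : H) x : \val h = idm x -> h = 1%g.
Proof.
by move=> e; apply: val_inj; have := domH h; rewrite e dom_idm /= => ->.
Qed.

Let v_inj : injective (fun h : H => comp a (\val h)).
Proof.
move=> h k e; apply: val_inj.
by rewrite -(@compKV _ a (\val h)) ?rngH // e compKV ?rngH.
Qed.

Let w_inj : injective (fun h : H => comp (\val h) (inv a)).
Proof.
move=> h k e; apply: val_inj.
by rewrite -(@comp_invK _ (\val h) a) ?domH // e comp_invK ?domH.
Qed.

Let v_group_ring : group_ring v.
Proof.
apply: sub_finite_set (finite_preimage (in2W v_inj) (mfin (dom a))) => h vh.
by split=> //; rewrite dom_comp ?rngH // domH.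
Qed.

Let w_group_ring : group_ring w.
Proof.
apply: sub_finite_set (finite_preimage (in2W w_inj) (m'fin (rng a))) => h wh.
by split=> //; rewrite dom_comp ?dom_inv // rng_inv domH.
Qed.

(** In the convolution [m' m] at [h] only arrows of the coset [a H] contribute, so it is the group
    ring product; and [m' m] is diagonal with value 1 at [dom a]. *)
Lemma isotropy_unit_mulVg : group_ring_mul w v = @group_ring_one R H.
Proof.
apply/funext => h.
have -> : group_ring_mul w v h = convolution m' m (\val h).
  rewrite /convolution domH.
  rewrite -(@fsbig_widen _ _ _ _ (range (fun k : H => comp a (\val k)))).
  - rewrite fsbig_image; last by move=> k l _ _ /v_inj.
    apply: eq_fsbigr => k _; rewrite /v /w valM valV; congr (m' _ * _).
    by rewrite inv_compE ?rngH // compA ?rng_inv ?dom_inv ?domH ?rngH.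
  - by move=> _ [k _ <-]; rewrite /= dom_comp ?rngH // domH.
  - move=> b [/= ba Nb]; have [->|mb] := eqVneq (m b) 0; first by rewrite mulr0.
    have [k bE] := supp_isotropy mb (or_introl ba).
    by case: Nb; exists k.
rewrite /group_ring_one /group_ring_monomial.
case: (eqVneq h 1%g) => [->|h1]; first by rewrite /= m'm_dom1.
apply/eqP; apply: contraNT h1 => /m'm_unit/unit_idm_dom/val_idm ->; exact: eqxx.
Qed.


Lemma isotropy_unit_mulgV : group_ring_mul v w = @group_ring_one R H.
Proof.
apply/funext => h.
have ah : dom a = rng (\val h) by rewrite rngH.
have aha : dom (comp a (\val h)) = rng (inv a).
  by rewrite dom_comp // domH rng_inv.
(* Conjugation by [a] carries [h] to the isotropy at [rng a], where [m m'] is evaluated. *)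
have -> : group_ring_mul v w h =
    convolution m m' (comp (comp a (\val h)) (inv a)).
  rewrite /convolution dom_comp // dom_inv.
  rewrite -(@fsbig_widen _ _ _ _ (range (fun k : H => comp (\val k) (inv a)))).
  - rewrite fsbig_image; last by move=> k l _ _ /w_inj.
    apply: eq_fsbigr => k _; rewrite /v /w valM valV; congr (m _ * _).
    have ka : dom (\val k) = rng (inv a) by rewrite rng_inv domH.
    rewrite inv_compE // invK [RHS]compA ?dom_comp ?dom_inv ?rng_inv ?rngH //.
    by rewrite comp_invK ?dom_comp ?domH // compA ?rng_inv ?domH.
  - move=> _ [k _ <-]; rewrite /= dom_comp ?dom_inv //.
    by rewrite rng_inv domH.
  - move=> b [/= ba Nb].
    (* Nothing is assumed on the support of [m'], so the support of [m] must locate [b]: from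
       [e = a k] follows [b = k^-1 h a^-1]. *)
    set e := comp (comp (comp a (\val h)) (inv a)) (inv b).
    have [->|me] := eqVneq (m e) 0; first by rewrite mul0r.
    have re : rng e = rng a by rewrite /e !rng_comp ?dom_comp ?rng_inv ?dom_inv.
    have [k ek] := supp_isotropy me (or_intror re).
    case: Nb; exists (k^-1 * h)%g => //; rewrite valM valV.
    have eb : dom e = rng b by rewrite /e !dom_comp ?dom_inv ?rng_inv.
    rewrite -[RHS](compKV eb) [comp e b]comp_invK; last first.
      by rewrite dom_comp // dom_inv.
    rewrite ek inv_compE ?rngH // [RHS]compA; first last.
    - by rewrite dom_comp // rng_inv domH.
    - by rewrite dom_comp ?dom_inv ?rng_inv ?rng_comp ?rngH.
    rewrite -[comp (comp _ _) (comp a _)]compA; first by rewrite compKV.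
    - by rewrite dom_inv rng_inv rngH.
    - by rewrite dom_inv rng_comp.
rewrite /group_ring_one /group_ring_monomial.
case: (eqVneq h 1%g) => [->|h1]; first by rewrite /= comp_idm comp_inv mm'_rng1.
apply/eqP; apply: contraNT h1 => /mm'_unit/unit_idm_dom ae; apply/eqP/v_inj.
rewrite /= comp_idm -[LHS](@comp_invK _ _ a) ?dom_comp ?domH // ae.
by rewrite dom_comp // dom_inv idm_comp.
Qed.

Lemma isotropy_coeff_unit : group_ring_units v.
Proof.
split=> //; exists w => //.
by split; [exact: isotropy_unit_mulgV | exact: isotropy_unit_mulVg].
Qed.

(** The unit [v] is a monomial, yet nonzero both at 1, with value [m a], and at the [k] with
    [b = a k], with value [m b]. Hence [k] is 1. *)
Lemma supp_dom_inj b : no_nontrivial_units R H ->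
  m b != 0 -> dom b = dom a -> b = a.
Proof.
move=> nu mb ba; have := isotropy_coeff_unit; rewrite nu => -[r [h0 [_ vE]]].
have [k bE] := supp_isotropy mb (or_introl ba).
have h01 h : v h != 0 -> h = h0.
  by rewrite vE /group_ring_monomial; case: (h =P h0) => // _; rewrite eqxx.
have k1 : k = 1%g.
  rewrite [LHS](h01 k) ?[RHS](h01 1%g) // /v /=; first by rewrite comp_idm.
  by rewrite -bE.
by rewrite bE k1 /= comp_idm.
Qed.

End Isotropy.
End NormalizerFibers.

(** * Étale topology and compactly supported functions *)

Lemma locally_constant_open_supp (R : comPzRingType) (GG : topological_groupoid)
    (f : arr GG -> R) : locally_constant f -> open (supp f).
Proof.
move=> lf; rewrite openE => a fa; rewrite /interior.
by apply: filterS (lf a) => b; rewrite /supp /= => ->.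
Qed.

Lemma near_neq (X T : topologicalType) (f g : X -> T) z :
  hausdorff_space T -> f @ z --> f z -> g @ z --> g z ->
  f z <> g z -> \forall e \near z, f e <> g e.
Proof.
rewrite open_hausdorff => hT cf cg /eqP/hT[[A B] /= [/set_mem Af /set_mem Bg]].
move=> [oA oB /eqP AB].
have nA : \forall e \near z, A (f e) by apply: cf; exact: open_nbhs_nbhs.
have nB : \forall e \near z, B (g e) by apply: cg; exact: open_nbhs_nbhs.
apply: filterS2 nA nB => e Ae Be eE.
have : (A `&` B) (f e) by split=> //; rewrite eE.
by rewrite AB.
Qed.

Section EtaleTopology.
Context (GG : etale_groupoid).
Implicit Types (a b : arr GG) (x y : obj GG).

(** The local inverse of [dom] is a total function with arbitrary values far from [dom a], so its
    properties are stated near the base point only. *)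
Lemma etale_section a : exists s : obj GG -> arr GG,
  [/\ s @ dom a --> a, \forall y \near dom a, dom (s y) = y
    & \forall e \near a, s (dom e) = e].
Proof.
have [U [oU Ua oV [s [_ cs sK]]]] := etale_dom a.
have Va : (@dom GG @` U) (dom a) by exists a.
exists s; split.
- rewrite continuous_open_subspace // in cs.
  have := cs _ (mem_set Va).
  by rewrite /continuous_at sK ?inE.
- have : \forall y \near dom a, (@dom GG @` U) y by apply: open_nbhs_nbhs.
  by apply: filterS => _ [e Ue <-]; rewrite sK ?inE.
- have : \forall e \near a, U e by apply: open_nbhs_nbhs.
  by apply: filterS => e Ue; rewrite sK ?inE.
Qed.

Lemma open_dom (U : set (arr GG)) : open U -> open (@dom GG @` U).
Proof.
move=> oU; rewrite openE => _ [a Ua <-]; rewrite /interior.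
have [s [cs sK _]] := etale_section a.
have sU : \forall y \near dom a, U (s y) by apply: cs; exact: open_nbhs_nbhs.
by apply: filterS2 sK sU => y sy Usy; exists (s y).
Qed.

Lemma idm_dom_continuous : continuous (fun a => idm (dom a) : arr GG).
Proof.
by move=> a; apply: continuous_comp;
  [exact: dom_continuous | exact: idm_continuous].
Qed.

(** Near a unit, [e] and [idm (dom e)] both lie where [s] inverts [dom]; having the same domain,
    they coincide. *)
Lemma open_range_idm : open (range (@idm GG)).
Proof.
rewrite openE => _ [x _ <-]; rewrite /interior.
have [s [_ _ sK]] := etale_section (idm x).
have sK' : \forall e \near idm x, s (dom (idm (dom e))) = idm (dom e).
  have := @idm_dom_continuous (idm x); rewrite /continuous_at dom_idm.
  by move=> /(_ _ sK).
apply: filterS2 sK sK' => e; rewrite dom_idm => -> eE.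
by exists (dom e).
Qed.

Hypothesis arr_hausdorff : hausdorff_space (arr GG).

Lemma closed_range_idm : closed (range (@idm GG)).
Proof.
rewrite -[X in closed X]setCK; apply: open_closedC; rewrite openE => a Na.
have : \forall e \near a, e <> idm (dom e).
  apply: (@near_neq _ _ id (fun e => idm (dom e))) => //.
    exact: idm_dom_continuous.
  by move=> ae; apply: Na; exists (dom a).
by apply: filterS => e Ne /unit_idm_dom.
Qed.

Hypothesis obj_hausdorff : hausdorff_space (obj GG).
Context (R : comPzRingType).

Definition unit_indicator (W : set (obj GG)) : arr GG -> R :=
  fun a => if `[< (@idm GG @` W) a >] then 1 else 0.

Lemma unit_indicatorT (W : set (obj GG)) x :
  W x -> unit_indicator W (idm x) = 1.
Proof.
by move=> Wx; rewrite /unit_indicator ifT //; apply/asboolP; exists x.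
Qed.

Lemma unit_indicatorF (W : set (obj GG)) x :
  ~ W x -> unit_indicator W (idm x) = 0.
Proof.
move=> NWx; rewrite /unit_indicator ifF //.
apply/asboolPn => -[y Wy /(congr1 (@dom GG))].
by rewrite !dom_idm => yx; rewrite yx in Wy.
Qed.

Lemma unit_indicator_idem (W : set (obj GG)) a :
  unit_indicator W a * unit_indicator W a = unit_indicator W a.
Proof. by rewrite /unit_indicator; case: ifP; rewrite ?mulr1 ?mulr0. Qed.

Lemma unit_indicator_diagonal (W : set (obj GG)) :
  open W -> compact W -> diagonal (unit_indicator W).
Proof.
move=> oW kW; set I := @idm GG @` W.
have IE : I = range (@idm GG) `&` @dom GG @^-1` W.
  apply/seteqP; split=> [_ [x Wx <-]|_ [[x _ <-]]]; last first.
    by rewrite /= dom_idm => Wx; exists x.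
  by split; [exists x | rewrite /= dom_idm].
have dc : continuous (@dom GG) by exact: dom_continuous.
have oI : open I.
  rewrite IE; apply: openI; first exact: open_range_idm.
  by apply: open_comp oW => a _; exact: dc.
have cI : closed I.
  rewrite IE; apply: closedI; first exact: closed_range_idm.
  by apply: closed_comp; [move=> a _; exact: dc | exact: compact_closed].
have kI : compact I.
  apply: continuous_compact kW; apply: continuous_subspaceT.
  exact: idm_continuous.
have lcW : locally_constant (unit_indicator W).
  move=> a; rewrite /unit_indicator; case: asboolP => [Ia|NIa].
    have : \forall b \near a, I b by exact: open_nbhs_nbhs.
    by apply: filterS => b Ib; rewrite ifT //; apply/asboolP.
  have : \forall b \near a, (~` I) b.
    by apply: open_nbhs_nbhs; split => //; exact: closed_openC.
  by apply: filterS => b Ib; rewrite ifF //; apply/asboolPn.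
(* Only an inclusion, as [R] may be the zero ring here; the support is then compact as a closed
   subset of [I]. *)
have sI : supp (unit_indicator W) `<=` I.
  move=> a; rewrite /supp /= /unit_indicator; case: asboolP => //.
  by rewrite eqxx.
split; last by move=> a /sI [x _ <-]; exists x.
split=> //; apply: (subclosed_compact _ kI sI).
rewrite -[X in closed X]setCK; apply: open_closedC; rewrite openE => a Na.
apply: filterS (lcW a) => b; rewrite /supp /= => ->; exact: Na.
Qed.

Lemma groupoid_algebra_dom_finite (f : arr GG -> R) :
  groupoid_algebra f -> dom_finite f.
Proof.
move=> [_ kf] x; set K := [set _ | _ /\ _].
have KE : K = supp f `&` @dom GG @^-1` [set x].
  by apply/seteqP; split=> a [].
have kK : compact K.
  rewrite KE; apply: compact_closedI => //.
  apply: closed_comp; first by move=> a _; exact: dom_continuous.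
  by apply/accessible_closed_set1/hausdorff_accessible.
have [//|infK] := pselect (finite_set K).
(* Cofinite filter on the compact fibre [K]. A cluster point [a] would have a neighbourhood on which
   [dom] is injective, and this meets [K] at most in [a]. *)
pose F : set_system (arr GG) := [set B | finite_set (K `\` B)].
have FF : ProperFilter F.
  split; first by rewrite /F /= setD0.
  split; rewrite /F /=.
  - by rewrite setDT.
  - move=> A B fA fB; rewrite /= setDIr finite_setU; exact: (conj fA fB).
  - by move=> A B AB; apply: sub_finite_set => a [Ka NB]; split=> // /AB.
have [|a [[ax _] Fa]] := kK F FF; first by rewrite /F /= setDv.
have [s [_ _ sK]] := etale_section a.
have Fna : F (K `\ a).
  apply: sub_finite_set (finite_set1 a) => b [Kb NKb].
  by apply: contrapT => ba; exact: NKb.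
have [b [[[bx _] ba] sb]] := Fa _ _ Fna sK.
by case: ba; rewrite /= -sb bx -ax (nbhs_singleton sK).
Qed.

(** The normalizer condition speaks of [m e m'] with [e] diagonal. Taking for [e] the indicator of
    the compact open set of domains of the support turns it into a condition on [m m']. *)
Lemma convolution_local_unit (f : arr GG -> R) : groupoid_algebra f ->
  exists2 e, diagonal e &
    forall f', convolution (convolution f e) f' = convolution f f'.
Proof.
move=> [lf kf]; set W := @dom GG @` supp f.
have dW : diagonal (unit_indicator W).
  apply: unit_indicator_diagonal.
    exact/open_dom/locally_constant_open_supp.
  apply: continuous_compact kf; apply: continuous_subspaceT.
  exact: dom_continuous.
exists (unit_indicator W) => // f'; congr convolution.
apply/funext => a; rewrite convolution_unitr; last exact: dW.2.
have [->|fa] := eqVneq (f a) 0; first by rewrite mul0r.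
by rewrite unit_indicatorT ?mulr1 //; exists a.
Qed.

End EtaleTopology.

Lemma boolean_space_separation (X : topologicalType) (x y : X) :
  boolean_space X -> x <> y ->
  exists W : set X, [/\ open W, compact W, W x & ~ W y].
Proof.
move=> [hX [_ bX]] /eqP /(hausdorff_accessible hX)[U [oU xU yU]].
have [W [[oW kW] Wx] WU] := bX x U (open_nbhs_nbhs (conj oU (set_mem xU))).
by exists W; split=> // /WU; exact: (set_mem yU).
Qed.

(** * Interior of the isotropy in degree 1 *)

Section InteriorIsotropy.
Context (GG : etale_groupoid) (G : groupType) (c : cocycle GG G).
Context (U : set (arr GG)) (g : G).
Hypothesis openU : open U.
Hypothesis Ug : U `<=` homogeneous_arr c g.
Hypothesis U_dom : forall a b, U a -> U b -> rng a = rng b -> dom a = dom b.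

(** For [e] near [a^-1 b], let [t e] be the arrow over [dom e] on the local section through [b].
    Then [t e] is near [b] and [(t e) e^-1] is near [a], so both lie in [U]. They share their range,
    hence their domain, which says [dom e = rng e]. *)
Lemma inv_comp_isotropy_interior a b : U a -> U b -> rng a = rng b ->
  isotropy_interior_arr (trivial_component c) (comp (inv a) b).
Proof.
move=> Ua Ub ab; have dab := U_dom Ua Ub ab.
rewrite isotropy_interior_arrE; last exact: open_trivial_component.
set e0 := comp (inv a) b.
have ib : dom (inv a) = rng b by rewrite dom_inv.
have de0 : dom e0 = dom b by rewrite dom_comp.
have re0 : rng e0 = dom b by rewrite rng_comp // rng_inv.
have c0 : sub_arr (trivial_component c) e0.
  have /= ca := Ug Ua; have /= cb := Ug Ub.
  have := cocycle_comp c (esym (rng_inv a)).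
  rewrite comp_inv cocycle_idm ca => /(congr1 (fun z => g^-1 * z)%g).
  rewrite mulg1 mulKg => civ.
  by rewrite /= /homogeneous_arr /= cocycle_comp // cb -civ mulVg.
have [s [cs sdom sK]] := etale_section b.
pose t (e : arr GG) := s (dom e).
have t0 : t e0 = b by rewrite /t de0 (nbhs_singleton sK).
have ct : t @ e0 --> b.
  apply: cvg_comp cs; rewrite -de0; exact: dom_continuous.
have Ut : \forall e \near e0, U (t e) by apply: ct; exact: open_nbhs_nbhs.
have tdom : \forall e \near e0, dom (t e) = dom e.
  by have := @dom_continuous GG e0; rewrite /continuous_at de0 => /(_ _ sdom).
(* The premise is composability: composition is continuous only on composable pairs. *)
have Uu : \forall e \near e0, dom (t e) = dom e -> U (comp (t e) (inv e)).
  pose p (e : arr GG) := (t e, inv e).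
  have cp : p @ e0 --> p e0.
    apply: cvg_pair; first by rewrite /= t0.
    exact: inv_continuous.
  have Dp : [set q : arr GG * arr GG | dom q.1 = rng q.2] (p e0).
    by rewrite /= t0 rng_inv de0.
  have /subspace_continuousP/(_ _ Dp)/(_ U) := @comp_continuous GG.
  have pe0 : comp (t e0) (inv e0) = a.
    rewrite t0 inv_compE // invK compA ?dom_inv ?rng_inv ?ab //.
    by rewrite comp_inv -ab idm_comp.
  rewrite /from_subspace /= pe0 => /(_ (open_nbhs_nbhs (conj openU Ua))) Un.
  suff : \forall e \near e0, dom (t e) = rng (inv e) ->
      U (comp (t e) (inv e)).
    by apply: filterS => e Ue te; apply: Ue; rewrite te rng_inv.
  exact: cp Un.
have nc : \forall e \near e0, sub_arr (trivial_component c) e.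
  by apply: open_nbhs_nbhs; split=> //; exact: open_trivial_component.
rewrite /interior; near=> e.
have te : dom (t e) = dom e by near: e.
have Ute : U (t e) by near: e.
have Uue : U (comp (t e) (inv e)) by move: te; near: e.
split; first by near: e.
rewrite -te -[rng e]dom_inv -[dom (inv e)](@dom_comp _ (t e)) ?rng_inv //.
by apply: U_dom => //; rewrite rng_comp ?rng_inv.
Unshelve. all: by end_near. Qed.

End InteriorIsotropy.

(** * Local bisections by density *)

Theorem theorem4p12 (G : groupType) (R : comPzRingType) (GG : etale_groupoid)
    (c : cocycle GG G) :
  indecomposable R ->
  ample GG ->
  hausdorff_space (arr GG) ->
  dense [set x : obj GG | no_nontrivial_units R (interior_isotropy_group c x)] ->
  local_bisection_hypothesis R c.
Proof.
move=> Rind GGample hA good m [g _ [[mA mg] [m' [m'A _]]]].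
move=> [mm'm _ mDm' m'Dm].
have hO : hausdorff_space (obj GG) by case: GGample.
have mfin := groupoid_algebra_dom_finite hO mA.
have m'fin := groupoid_algebra_dom_finite hO m'A.
have mm'_unit : supp (convolution m m') `<=` range (@idm GG).
  by have [e De <-] := convolution_local_unit hA hO mA; exact: (mDm' _ De).2.
have m'm_unit : supp (convolution m' m) `<=` range (@idm GG).
  by have [e De <-] := convolution_local_unit hA hO m'A; exact: (m'Dm _ De).2.
have dom_rng a b : m a != 0 -> m b != 0 -> dom a = dom b -> rng a = rng b.
  move=> ma mb ab; apply: contrapT => /(boolean_space_separation GGample).
  move=> [W [oW kW Wa Wb]].
  have DW : diagonal (unit_indicator R W) by exact: unit_indicator_diagonal.
  apply: (@supp_rng_indicator _ _ Rind _ _ mfin m'fin mm'm mm'_unit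
    (unit_indicator R W) DW.2 _ _ a b) => //.
  - exact: unit_indicator_idem.
  - exact: (m'Dm _ DW).2.
  - exact: unit_indicatorT.
  - exact: unit_indicatorF.
have rng_dom a b : m a != 0 -> m b != 0 -> rng a = rng b -> dom a = dom b.
  move=> ma mb ab; apply: contrapT => /(boolean_space_separation GGample).
  move=> [W [oW kW Wa Wb]].
  have DW : diagonal (unit_indicator R W) by exact: unit_indicator_diagonal.
  apply: (@supp_dom_indicator _ _ Rind _ _ mfin m'fin mm'm m'm_unit
    (unit_indicator R W) DW.2 _ _ a b) => //.
  - exact: unit_indicator_idem.
  - exact: (mDm' _ DW).2.
  - exact: unit_indicatorT.
  - exact: unit_indicatorF.
have om : open (supp m) by exact: locally_constant_open_supp mA.1.
pose S := isotropy_interior (open_trivial_component c).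
have eq_good a b : no_nontrivial_units R (interior_isotropy_group c (dom a)) ->
    m a != 0 -> m b != 0 -> dom b = dom a -> b = a.
  move=> nu ma mb ba.
  apply: (@supp_dom_inj _ _ Rind _ _ mfin m'fin mm'm mm'_unit m'm_unit S a)
    => //.
  move=> e me ea.
  (* Domain and range determine each other on the support, so under either alternative [a^-1 e] is
     an isotropy arrow at [dom a]. *)
  have [de re] : dom e = dom a /\ rng e = rng a.
    by case: ea => h; split=> //; [exact: dom_rng | exact: rng_dom].
  have Se : isotropy_at S (dom a) (comp (inv a) e).
    split; last by rewrite dom_comp ?dom_inv // rng_comp ?dom_inv // rng_inv.
    exact: (@inv_comp_isotropy_interior _ _ c (supp m) g).
  exists (exist (fun e => e \in isotropy_at S (dom a)) _ (mem_set Se)) => /=.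
  by rewrite compVK.
have dom_inj a b : m a != 0 -> m b != 0 -> dom a = dom b -> a = b.
  move=> ma mb ab; apply: contrapT => Nab.
  (* Two distinct arrows over one object spread along local sections to distinct arrows of the
     support over every nearby object. Density supplies such an object where [eq_good] forbids
     this. *)
  have [s [cs sdom sK]] := etale_section a.
  have [t [ct tdom tK]] := etale_section b.
  have sa : s (dom a) = a := nbhs_singleton sK.
  have tb : t (dom a) = b by rewrite ab; exact: nbhs_singleton tK.
  rewrite -ab in ct tdom.
  have nst : \forall y \near dom a, s y <> t y.
    by apply: (near_neq hA); rewrite ?sa ?tb.
  have ns : \forall y \near dom a, m (s y) != 0.
    by apply: (cs (supp m)); apply: open_nbhs_nbhs.
  have nt : \forall y \near dom a, m (t y) != 0.
    by apply: (ct (supp m)); apply: open_nbhs_nbhs.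
  have : nbhs (dom a) [set y | s y <> t y /\
      [/\ m (s y) != 0, m (t y) != 0, dom (s y) = y & dom (t y) = y]].
    apply: filterS2 nst _; last first.
      apply: filterS3 ns nt _; last exact: filterI sdom tdom.
      by move=> y; exact: And3.
    by move=> y sty [? ? [? ?]].
  rewrite nbhsE => -[O [oO Oa] OP].
  have [|y [Oy gy]] := good O _ oO; first by exists (dom a).
  have [st [msy mty sy ty]] := OP y Oy.
  by case: st; apply/esym/eq_good; rewrite ?sy ?ty.
split=> // a b /set_mem ma /set_mem mb ab; apply: dom_inj => //.
exact: rng_dom.
Qed.
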